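(* Let $\alpha\in[1,\omega_1)$ be an ordinal and let $p\in[1,+\infty)$. Then there exists a strongly separately continuous function $f:\ell_p\to\mathbb R$ which belongs to the $(\alpha+1)$'th Baire class and does not belong to the $\alpha$'th Baire class.
   Context: $\ell_p$ is the space of all real sequences $x=(x_n)_{n=1}^\infty$ with $\sum_{n=1}^\infty|x_n|^p<\infty$, with the topology of the norm $\|x\|_p=(\sum_{n=1}^\infty|x_n|^p)^{1/p}$. For $x,a\in\ell_p$ and $k\in\mathbb N$, let $x_k^a$ be the sequence obtained from $x$ by replacing its $k$-th coordinate $x_k$ by $a_k$. A function $f:\ell_p\to\mathbb R$ is strongly separately continuous if for every $a\in\ell_p$ and every $k\in\mathbb N$ one has $\lim_{x\to a}|f(x)-f(x_k^a)|=0$, where $x\to a$ in the norm topology. Baire classes of functions $\ell_p\to\mathbb R$: the $0$'th Baire class consists of the continuous functions (for the norm topology); for $1\le\alpha<\omega_1$ the $\alpha$'th Baire class consists of the pointwise limits of sequences $(f_n)_{n=1}^\infty$ of functions such that each $f_n$ belongs to the $\beta_n$'th Baire class for some $\beta_n<\alpha$. *)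

(* Defs.v *)
From HB Require Import structures.
From mathcomp Require Import all_boot all_order all_algebra.
From mathcomp Require Import all_classical all_reals all_analysis.
From mathcomp Require Import wochoice.

Set Implicit Arguments.
Unset Strict Implicit.
Unset Printing Implicit Defensive.

Import Order.TTheory GRing.Theory Num.Theory.
Import numFieldNormedType.Exports.

Local Open Scope classical_set_scope.
Local Open Scope ring_scope.

Section ellp_pred.
Context {R : realType} (p : R).

Definition sum_powR (x : nat -> R) : \bar R :=
  (\sum_(n <oo) (`|x n| `^ p)%:E)%E.

Definition ellp_pred : {pred (nat -> R)} :=
  mem [set x | (sum_powR x < +oo)%E].

End ellp_pred.

(* [p1] is a parameter of the type because its canonical structures depend on
   it. Coordinates are indexed from 0. *)
Record ellp (R : realType) (p : R) (p1 : 1 <= p) := Ellp {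
  ellp_val :> nat -> R ;
  _ : ellp_val \in ellp_pred p
}.

Section ellp.
Context {R : realType} {p : R} (p1 : 1 <= p).
Implicit Types x y : nat -> R.

Local Notation sum_powR := (sum_powR p).
Local Notation ellp_pred := (ellp_pred p).
Local Notation ellp := (ellp p1).

Let p0 : 0 < p. Proof. exact: lt_le_trans ltr01 p1. Qed.
Let pN0 : p != 0. Proof. exact: lt0r_neq0. Qed.

Lemma ellp_predE x : (x \in ellp_pred) = (sum_powR x < +oo)%E.
Proof. by apply/idP/idP => [|h]; rewrite inE. Qed.

Lemma sum_powR_ge0 x : (0 <= sum_powR x)%E.
Proof. by apply: nneseries_ge0 => n _ _; rewrite lee_fin powR_ge0. Qed.

Lemma sum_powR_Lnorm x :
  ('N[counting]_p%:E [EFin \o x] = sum_powR x `^ p^-1)%E.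
Proof.
by rewrite Lnorm_counting//; congr (_ `^ _)%E; apply: eq_eseriesr => n _.
Qed.

Lemma ellp_pred_Lfun x : (x \in ellp_pred) = (x \in Lfun counting p%:E).
Proof.
rewrite ellp_predE; apply/idP/idP => [xp|].
- rewrite inE; apply/andP; split; first exact: mem_set.
  by apply: mem_set; rewrite /= /finite_norm sum_powR_Lnorm poweR_lty.
- rewrite inE => /andP[_ /set_mem]; rewrite /= /finite_norm sum_powR_Lnorm.
  by apply: lty_poweRy; rewrite invr_eq0.
Qed.

Lemma ellp_submod_closed : submod_closed ellp_pred.
Proof.
have [? h] := @Lfun_submod_closed _ _ _ (@counting nat R) p%:E p1.
split; first by rewrite ellp_pred_Lfun.
by move=> c x y; rewrite !ellp_pred_Lfun; exact: h.
Qed.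

HB.instance Definition _ :=
  GRing.isSubmodClosed.Build R (nat -> R) ellp_pred ellp_submod_closed.

HB.instance Definition _ := [isSub of ellp for (@ellp_val R p p1)].
HB.instance Definition _ := [Choice of ellp by <:].
HB.instance Definition _ := [SubChoice_isSubLmodule of ellp by <:].

Definition ellp_norm (x : ellp) : R := fine (sum_powR x) `^ p^-1.

Lemma ellp_sum_fin (x : ellp) : sum_powR x \is a fin_num.
Proof.
by rewrite ge0_fin_numE ?sum_powR_ge0// -ellp_predE; exact: (valP x).
Qed.

Lemma ellp_normE (x : ellp) :
  ((ellp_norm x)%:E = 'N[counting]_p%:E [EFin \o (x : nat -> R)])%E.
Proof.
by rewrite sum_powR_Lnorm -(fineK (ellp_sum_fin x)) poweR_EFin.
Qed.

Lemma ellp_normD (x y : ellp) : ellp_norm (x + y) <= ellp_norm x + ellp_norm y.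
Proof.
have := @minkowski_EFin _ nat R counting (ellp_val x) (ellp_val y) p.
move=> /(_ (fun _ _ _ => I) (fun _ _ _ => I) p1).
have -> : ellp_val x \+ ellp_val y = ellp_val (x + y) by [].
by rewrite -(ellp_normE x) -(ellp_normE y) -(ellp_normE (x + y)) -EFinD lee_fin.
Qed.

Lemma ellp_normZ (c : R) (x : ellp) : ellp_norm (c *: x) = `|c| * ellp_norm x.
Proof.
have xL : ellp_val x \in Lfun counting p%:E.
  by rewrite -ellp_pred_Lfun; exact: (valP x).
have := LnormZ (Lfun_Sub (p1 : (1 <= p%:E)%E) xL) c.
have -> : c \*: (Lfun_Sub (p1 : (1 <= p%:E)%E) xL : nat -> R) =
  ellp_val (c *: x) by [].
rewrite Lfun_valP.
by rewrite -(ellp_normE x) -(ellp_normE (c *: x)) -EFinM => -[].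
Qed.

Lemma ellp_norm_eq0 (x : ellp) : ellp_norm x = 0 -> x = 0.
Proof.
move=> /powR_eq0_eq0 sx0; apply: val_inj; apply: funext => n /=.
have xn_ge0 k : (0 <= (`|x k| `^ p)%:E)%E by rewrite lee_fin powR_ge0.
have : (sum_powR x <= 0)%E by rewrite -(fineK (ellp_sum_fin x)) sx0.
rewrite /sum_powR (@nneseriesD1 _ _ n)// => /(le_trans (leeDl _ _)).
move=> /(_ (nneseries_ge0 (fun k _ _ => xn_ge0 k))); rewrite lee_fin => xn_le0.
apply/normr0_eq0/(@powR_eq0_eq0 _ _ p)/eqP.
by rewrite eq_le xn_le0 powR_ge0.
Qed.

HB.instance Definition _ :=
  Lmodule_isNormed.Build R ellp ellp_normD ellp_normZ ellp_norm_eq0.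

Lemma replace_coord_subproof (a x : ellp) (k : nat) :
  (fun n => if n == k then a k else x n) \in ellp_pred.
Proof.
have xa : (sum_powR x + sum_powR a < +oo)%E.
  by rewrite lte_add_pinfty// -ellp_predE; exact: valP.
rewrite ellp_predE (le_lt_trans _ xa)// /sum_powR -nneseriesD; last 2 first.
- by move=> n _ _; rewrite lee_fin powR_ge0.
- by move=> n _ _; rewrite lee_fin powR_ge0.
apply: lee_nneseries => [n _ _|n _]; first by rewrite lee_fin powR_ge0.
rewrite -EFinD lee_fin; case: eqP => [->|_].
  by rewrite lerDr powR_ge0.
by rewrite lerDl powR_ge0.
Qed.

(* x_k^a *)
Definition replace_coord (a : ellp) (k : nat) (x : ellp) : ellp :=
  Ellp p1 (replace_coord_subproof a x k).

Definition strongly_separately_continuous (f : ellp -> R) : Prop :=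
  forall (a : ellp) (k : nat),
    `|f x - f (replace_coord a k x)| @[x --> a] --> 0.

End ellp.

(* A countable ordinal, presented as a countable well-ordered set of that order
   type; its elements stand for the ordinals strictly below it. *)
Record countable_ordinal := CountableOrdinal {
  ord_sort :> Type ;
  ord_le : rel ord_sort ;
  ord_wo : well_order ord_le ;
  ord_countable : countable [set: ord_sort]
}.

Definition ord_lt (alpha : countable_ordinal) (s t : alpha) : bool :=
  ~~ ord_le t s.

(* 1 <= alpha: there is an ordinal below alpha. *)
Definition ord_ge1 (alpha : countable_ordinal) : Prop := inhabited alpha.

Section successor.
Variable alpha : countable_ordinal.

(* alpha + 1: a greatest element None is added on top of alpha. *)
Definition succ_le : rel (option alpha) := fun s t =>
  match s, t with
  | _, None => true
  | None, Some _ => false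
  | Some s', Some t' => ord_le s' t'
  end.

Lemma succ_wo : well_order succ_le.
Proof.
move=> A [x Ax].
have [ex|nex] := pselect (nonempty [pred s | Some s \in A]).
  have [z [[Az zmin] zuniq]] := ord_wo ex.
  exists (Some z); split.
    by split=> // -[s /zmin//|].
  move=> [y|] [Ay ymin]; last by have := ymin _ Az.
  by congr Some; apply: zuniq; split => // s As; exact: (ymin (Some s)).
have onlyN y : y \in A -> y = None.
  by case: y => // s As; case: nex; exists s.
exists None; split=> [|y [/onlyN->//]].
by split=> [|y /onlyN->//]; rewrite -(onlyN _ Ax).
Qed.

Lemma succ_countable : countable [set: option alpha].
Proof.
have /pcard_leP/injfunPex[g _ ginj] := ord_countable alpha.
apply/pcard_leP/injfunPex.
exists (fun s => if s is Some s' then (g s').+1 else 0%N) => //.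
move=> [s|] [t|] _ _ //= [gst]; congr Some.
by apply: ginj gst; rewrite inE.
Qed.

Definition ord_succ : countable_ordinal :=
  CountableOrdinal succ_wo succ_countable.

End successor.

(* [baire_at t f]: f belongs to the Baire class indexed by the ordinal (below
   alpha) for which t stands, i.e. the order type of the elements below t. *)
Inductive baire_at {R : realType} {X : topologicalType}
    (alpha : countable_ordinal) : alpha -> (X -> R) -> Prop :=
| baire_at_zero (t : alpha) (f : X -> R) :
    (forall s : alpha, ord_le t s) -> continuous f -> baire_at t f
| baire_at_lim (t : alpha) (f : X -> R) (s : nat -> alpha) (F : nat -> X -> R) :
    (forall n, ord_lt (s n) t) -> (forall n, baire_at (s n) (F n)) ->
    (forall x, F n x @[n --> \oo] --> f x) -> baire_at t f.

(* alpha itself is the order type of the elements below the top of alpha + 1. *)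
Definition baire_class {R : realType} {X : topologicalType}
    (alpha : countable_ordinal) (f : X -> R) : Prop :=
  @baire_at R X (ord_succ alpha) None f.

(* Main.v *)
(* The function is the indicator of a set A of sequences x such that x \in A
   depends only on the support of x and is unaffected by changing one coordinate;
   then f(x) = f(x_k^a) and f is strongly separately continuous.

   Whether a support P belongs to A is decided by a pattern T_t, defined by
   recursion on the class t: T_0 holds iff P is nonempty, and T_t holds iff there
   are k, N such that for all n >= N and all s < t the block (k, n, s) of P does
   not satisfy T_s. "For all n >= N" makes T_t insensitive to finite changes.
   The shape of T_t is that of {lim g_n > 0}, so that T_t applied to open sets is
   in the additive class of t, and produces all sets {F > 0}, F of class t.

   If f had class alpha, then so would 1/2 - f. A sequence c of integers encodes a
   sequence of cylinders of the Baire space, and c |-> (4^-(i+1) [c is in the i-th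
   cylinder encoded by c])_i is continuous into l_p. The code c of the cylinders
   representing {f < 1/2} through T_alpha then satisfies f = 1 iff f < 1/2 at its
   image. *)
Require Import Defs.
From mathcomp Require Import all_boot all_order all_algebra.
From mathcomp Require Import all_classical all_reals all_analysis.
From mathcomp Require Import wochoice.

Set Implicit Arguments.
Unset Strict Implicit.
Unset Printing Implicit Defensive.

Import Order.TTheory GRing.Theory Num.Theory.
Import numFieldNormedType.Exports.

Local Open Scope classical_set_scope.
Local Open Scope ring_scope.

(** * Countable well-orders *)

Section ordinals.
Variable beta : countable_ordinal.
Implicit Types s t u : beta.

Lemma ord_min_ex (P : set beta) : P !=set0 ->
  exists2 s, P s & forall u, P u -> ord_le s u.
Proof.
move=> [x Px]; have [|z [[zP zmin] _]] := @ord_wo beta [pred u | `[< P u >]].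
  by exists x; exact/asboolP.
exists z; first exact/asboolP.
by move=> u Pu; apply: zmin; exact/asboolP.
Qed.

Lemma ord_le_total s t : ord_le s t || ord_le t s.
Proof.
have [|z [->|->] zmin] := @ord_min_ex [set u | u = s \/ u = t].
- by exists s; left.
- by rewrite zmin//; right.
- by rewrite (zmin s) ?orbT//; left.
Qed.

Lemma ord_lexx s : ord_le s s.
Proof. by have := ord_le_total s s; rewrite orbb. Qed.

(** Both elements are least in the pair [{s, t}], and [ord_wo] makes the least element unique. *)
Lemma ord_le_anti s t : ord_le s t -> ord_le t s -> s = t.
Proof.
move=> st ts.
have [|z [_ zuniq]] := @ord_wo beta [pred u | `[< u = s \/ u = t >]].
  by exists s; apply/asboolP; left.
have min u : (u = s \/ u = t) ->
    minimum_of (@ord_le beta) [pred u | `[< u = s \/ u = t >]] u.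
  move=> ust; split; first exact/asboolP.
  by move=> v /asboolP[]->; case: ust => ->//; exact: ord_lexx.
by rewrite -(zuniq _ (min s _)) ?(zuniq _ (min t _))//; [right|left].
Qed.

Lemma ord_le_eqVlt s t : ord_le s t -> s = t \/ ord_lt s t.
Proof.
by move=> st; case: (boolP (ord_le t s)) => ts; [left; exact: ord_le_anti|right].
Qed.

Lemma ord_ltW s t : ord_lt s t -> ord_le s t.
Proof. by have := ord_le_total s t; rewrite /ord_lt; case: ord_le => //= ->. Qed.

Lemma ord_ind (P : beta -> Prop) :
  (forall t, (forall s, ord_lt s t -> P s) -> P t) -> forall t, P t.
Proof.
move=> IH t; apply: contrapT => nPt.
have [|z nPz zmin] := @ord_min_ex [set u | ~ P u]; first by exists t.
by apply/nPz/IH => s; apply: contraNP => /zmin.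
Qed.

Lemma ord_bot_or_gt t : (forall s, ord_le t s) \/ exists s, ord_lt s t.
Proof.
have [|/existsNP[s /negP ?]] := pselect (forall s, ord_le t s); first by left.
by right; exists s.
Qed.

Lemma ord_sup s t u : ord_lt s u -> ord_lt t u ->
  exists v, [/\ ord_lt v u, ord_le s v & ord_le t v].
Proof.
by move=> su tu; have /orP[st|ts] := ord_le_total s t;
  [exists t|exists s]; split=> //; exact: ord_lexx.
Qed.

(* The initial segment below [t] is countable, hence enumerable as soon as it
   is nonempty. *)
Lemma ord_lt_enum t : (exists s, ord_lt s t) ->
  exists e : nat -> beta, (forall j, ord_lt (e j) t) /\
                          (forall s, ord_lt s t -> exists j, e j = s).
Proof.
move=> [s0 s0t]; have /pcard_leP/injfunPex[g _ ginj] := ord_countable beta.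
have /choice[e eP] (j : nat) : exists s, ord_lt s t /\
    forall u, ord_lt u t -> g u = j -> u = s.
  have [[u [ut gu]]|nu] := pselect (exists u, ord_lt u t /\ g u = j).
    exists u; split=> // v _ gv.
    by apply: ginj; rewrite ?inE// gv gu.
  by exists s0; split=> // u ut gu; case: nu; exists u.
exists e; split=> [j|s st]; first by have [] := eP j.
by exists (g s); have [_ /(_ s st erefl)] := eP (g s).
Qed.

End ordinals.

(** * Closure properties of Baire classes *)

Section baire.
Context {R : realType} {X : topologicalType} {beta : countable_ordinal}.
Implicit Types (s t u : beta) (f g : X -> R).

Lemma baire_at_inv t f : baire_at t f ->
  ((forall s, ord_le t s) /\ continuous f) \/
  exists (s : nat -> beta) (F : nat -> X -> R),
    [/\ (forall n, ord_lt (s n) t), (forall n, baire_at (s n) (F n)) &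
        forall x, F n x @[n --> \oo] --> f x].
Proof.
by case=> {t f} [t f tbot fc|t f s F st bF Ff]; [left|right; exists s, F].
Qed.

Lemma baire_at_mono s t f : ord_le s t -> baire_at s f -> baire_at t f.
Proof.
move=> /ord_le_eqVlt[->//|st bf].
by apply: (@baire_at_lim _ _ _ _ _ (fun=> s) (fun=> f)) => // x; exact: cvg_cst.
Qed.

Lemma baire_at_cst t (r : R) : baire_at t (fun _ : X => r).
Proof.
elim/ord_ind: t => t IH; have [tbot|[s st]] := ord_bot_or_gt t.
  by apply: baire_at_zero => // x; exact: cvg_cst.
exact: baire_at_mono (ord_ltW st) (IH _ st).
Qed.

Lemma baire_at_comp t f (h : R -> R) :
  continuous h -> baire_at t f -> baire_at t (h \o f).
Proof.
move=> hc; elim=> {t f} [t f tbot fc|t f s F st _ IH Ff].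
  by apply: baire_at_zero => // x; apply: continuous_comp; [exact: fc|exact: hc].
apply: (@baire_at_lim _ _ _ _ _ s (fun n => h \o F n)) => //.
by move=> x; apply: continuous_cvg; [exact: hc|exact: Ff].
Qed.

Lemma baire_at_max t f g : baire_at t f -> baire_at t g ->
  baire_at t (fun x => Num.max (f x) (g x)).
Proof.
elim/ord_ind: t f g => t IH f g /baire_at_inv bf /baire_at_inv bg.
case: bf => [[tbot fc]|[s [F [st bF Ff]]]].
  case: bg => [[_ gc]|[s [? [/(_ 0%N)/negP]]]]; last by rewrite tbot.
  by apply: baire_at_zero => // x; apply: continuous_max; [exact: fc|exact: gc].
case: bg => [[tbot _]|[s' [G [s't bG Gg]]]].
  by have /negP[] := st 0%N.
have /choice[u uP] n := ord_sup (st n) (s't n).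
apply: (@baire_at_lim _ _ _ _ _ u (fun n x => Num.max (F n x) (G n x))).
- by move=> n; have [] := uP n.
- move=> n; have [ut su s'u] := uP n.
  by apply: IH => //; [exact: baire_at_mono su _|exact: baire_at_mono s'u _].
- move=> x.
  under eq_fun do rewrite maxr_absE.
  rewrite maxr_absE; apply: cvgM; last exact: cvg_cst.
  apply: cvgD; first exact: cvgD (Ff x) (Gg x).
  exact: cvg_norm (cvgB (Ff x) (Gg x)).
Qed.

(** Finitely many classes below [t] have a largest one, so the bound [u] stays below [t] even at a
    limit. *)
Lemma baire_at_bigmax t (s : nat -> beta) (g : nat -> X -> R) (n : nat) :
  (forall q, ord_lt (s q) t) -> (forall q, baire_at (s q) (g q)) ->
  exists2 u, ord_lt u t & baire_at u (fun x => \big[Num.max/0]_(q < n) g q x).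
Proof.
elim: n s g => [|n IH] s g st bg.
  exists (s 0%N) => //; under eq_fun do rewrite big_ord0.
  exact: baire_at_cst.
have [u ut bM] := IH _ _ (fun q => st q.+1) (fun q => bg q.+1).
have [v [vt uv sv]] := ord_sup ut (st 0%N).
exists v => //; under eq_fun do rewrite big_ord_recl.
by apply: baire_at_max; [exact: baire_at_mono (bg 0%N)|exact: baire_at_mono bM].
Qed.

(* The indicator is the limit of [max 0 (1 - n * max_(q < n) (g q)^+)]. *)
Lemma baire_at_indic t (s : nat -> beta) (g : nat -> X -> R) :
  (forall q, ord_lt (s q) t) -> (forall q, baire_at (s q) (g q)) ->
  baire_at t (\1_[set x | forall q, g q x <= 0] : X -> R).
Proof.
move=> st bg; set M := fun n x => \big[Num.max/0]_(q < n) g q x.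
have /choice[u uP] n : exists u, ord_lt u t /\ baire_at u (M n).
  by have [u] := baire_at_bigmax n st bg; exists u.
apply: (@baire_at_lim _ _ _ _ _ u (fun n x => Num.max 0 (1 - n%:R * M n x))).
- by move=> n; have [] := uP n.
- move=> n; have [_ bM] := uP n.
  apply: (@baire_at_comp _ _ (fun y => Num.max 0 (1 - n%:R * y))) bM.
  move=> y.
  apply: (@continuous_max R R (cst 0) (fun y : R => 1 - n%:R * y) y); first exact: cvg_cst.
  apply: cvgB; first exact: cvg_cst.
  apply: cvgM; first exact: cvg_cst.
  exact: cvg_id.
- move=> x; rewrite indicE.
  have [gx|/existsNP[q /negP]] := pselect (forall q, g q x <= 0).
    rewrite mem_set//; apply: cvg_near_cst; apply: nearW => n.
    suff -> : M n x = 0 by rewrite mulr0 subr0 max_r.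
    by apply/le_anti; rewrite /M bigmax_le//= bigmax_ge_id.
  rewrite -ltNge => gq_gt0; rewrite memNset/=; last first.
    by move=> /(_ q); rewrite leNgt gq_gt0.
  (* Once [n > q] and [n >= 1 / g q x], the subtracted term is at least 1. *)
  apply: cvg_near_cst; near=> n.
  apply: max_l; rewrite subr_le0.
  apply: (@le_trans _ _ (n%:R * g q x)).
    rewrite -ler_pdivrMr//; near: n; exact: nbhs_infty_ger.
  apply: ler_wpM2l => //.
  have qn : (q < n)%N by near: n; exact: nbhs_infty_gt.
  exact: (@le_bigmax _ _ _ 0 (fun i : 'I_n => g i x) (Ordinal qn)).
Unshelve. all: by end_near.
Qed.

End baire.

(* The additive Borel class attached to [t], i.e. the cozero sets of suprema of
   sequences of functions of class [t]. *)
Definition baire_sigma {R : realType} {X : topologicalType}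
    {beta : countable_ordinal} (t : beta) (S : set X) : Prop :=
  exists h : nat -> X -> R,
    (forall n, baire_at t (h n)) /\ forall x, S x <-> exists n, 0 < h n x.

(** [None] codes the empty set, a filler for indices that carry no cylinder. *)
Definition cylinder (o : option (seq nat)) (c : nat -> nat) : bool :=
  if o is Some w then mkseq c (size w) == w else false.

Definition block (k n j : nat) (P : set nat) : set nat :=
  [set m | P (pickle (k, n, j, m))].

Definition tail_invariant (T : set (set nat)) : Prop :=
  forall (P Q : set nat) (i : nat),
    (forall l, l != i -> P l <-> Q l) -> T P -> T Q.

(** * Patterns and positivity sets of Baire functions *)

Section patterns.
Context {R : realType} {X : topologicalType} {beta : countable_ordinal}.
Variable psi : (nat -> nat) -> X.
(** Continuity of [psi] on the Baire space, in the form that is used: preimages of cozero sets are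
    open. *)
Hypothesis psiP : forall (F : X -> R), continuous F ->
  forall c, 0 < F (psi c) ->
  exists n, forall c', mkseq c' n = mkseq c n -> 0 < F (psi c').
Implicit Types (s t : beta) (T : set (set nat)).

Definition positivity_pattern (F : X -> R) T (W : nat -> option (seq nat)) :=
  forall c, 0 < F (psi c) <-> T [set i | cylinder (W i) c].

(* Applied to a sequence of cozero sets, [T] yields a set in the additive class
   of [t]; conversely every [{F > 0}] with [F] of class [t] is obtained, along
   [psi], by applying [T] to a sequence of cylinders. *)
Definition complete_pattern t T : Prop :=
  (forall Z : nat -> X -> R, (forall i, continuous (Z i)) ->
     @baire_sigma R X beta t [set x | T [set i | 0 < Z i x]]) /\
  (forall F : X -> R, baire_at t F -> exists W, positivity_pattern F T W).

(** An open set of the Baire space is the union of the countably many cylinders contained in it. *)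
Lemma complete_pattern_bot t : (forall s, ord_le t s) ->
  complete_pattern t [set P | exists m, P m].
Proof.
move=> tbot; split=> [Z Zc|F /baire_at_inv[[_ Fc]|[s [? [/(_ 0%N)/negP]]]]].
- by exists Z; split=> // n; exact: baire_at_zero.
- exists (fun m => if unpickle m is Some w then
    if `[< forall c, mkseq c (size w) = w -> 0 < F (psi c) >] then Some w
    else None else None) => c; split=> [Fc0|[m]].
    have [n nP] := psiP Fc Fc0.
    exists (pickle (mkseq c n)); rewrite /mkset pickleK size_mkseq.
    by case: asboolP => [_|[]//]; rewrite /cylinder size_mkseq eqxx.
  rewrite /mkset; case: unpickle => // w; case: asboolP => // wP /eqP; exact: wP.
- by rewrite tbot.
Qed.

(* With [F] the limit of [G n], [F > 0] holds iff for some [k], [1/(k+1) - G n]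
   is eventually nonpositive. The index [j] makes the pattern independent of the
   classes of the [G n]: blocks with the wrong class get the zero function. *)
Lemma complete_pattern_step t (e : nat -> beta) (T : nat -> set (set nat)) :
  (forall j, ord_lt (e j) t) -> (forall s, ord_lt s t -> exists j, e j = s) ->
  (forall j, complete_pattern (e j) (T j)) ->
  complete_pattern t [set P | exists k N, forall n j, (N <= n)%N ->
                                ~ T j (block k n j P)].
Proof.
move=> et te Tc; split=> [Z Zc|F bF].
- have /choice[h hP] (q : nat * nat * nat) : exists h : nat -> X -> R,
      (forall l, baire_at (e q.2) (h l)) /\ forall x,
      T q.2 (block q.1.1 q.1.2 q.2 [set i | 0 < Z i x]) <->
      exists l, 0 < h l x.
    move: q => [[k n] j] /=; have [+ _] := Tc j.
    by move=> /(_ (fun m => Z (pickle (k, n, j, m)))); apply=> i; exact: Zc.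
  (* For fixed [k, N], the index [q] runs over all [n = N + d], [j] and [l]. An undecodable [q]
     gives a harmless 0; an undecodable [kN] gives 1, which empties the set. *)
  pose g (kN q : nat) : nat * (X -> R) :=
    if unpickle kN is Some (k, N) then
      if unpickle q is Some (d, j, l) then (j, h (k, N + d, j)%N l)
      else (0%N, cst 0) else (0%N, cst 1).
  have bg kN q : baire_at (e (g kN q).1) (g kN q).2.
    rewrite /g; case: unpickle => [[k N]|]; last exact: baire_at_cst.
    case: unpickle => [[[d j] l]|]; last exact: baire_at_cst.
    by have [bh _] := hP (k, N + d, j)%N; exact: bh.
  exists (fun kN => \1_[set x | forall q, (g kN q).2 x <= 0]); split.
    by move=> kN; apply: (baire_at_indic (s := fun q => e (g kN q).1)).
  move=> x; split=> /=.
  + move=> [k [N kN]]; exists (pickle (k, N)).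
    rewrite indicE mem_set ?ltr01// => q; rewrite /g pickleK.
    case: unpickle => [[[d j] l]|]//=; rewrite leNgt; apply/negP => hl.
    apply: (kN (N + d)%N j); first exact: leq_addr.
    by apply/(proj2 (hP (k, N + d, j)%N)); exists l.
  + move=> [kN]; rewrite indicE; case: (boolP (_ \in _)); last by rewrite ltxx.
    rewrite inE /g /= => + _; case: (unpickle kN) => [[k N]|]; last first.
      by move=> /(_ 0%N) /=; rewrite ler10.
    move=> gle; exists k, N => n j Nn /(proj2 (hP (k, n, j))) [l].
    by have := gle (pickle (n - N, j, l)%N); rewrite pickleK /= subnKC// leNgt => /negP.
- have [[tbot _]|[s [G [st bG GF]]]] := baire_at_inv bF.
    by have /negP := et 0%N; rewrite tbot.
  have /choice[W WP] (q : nat * nat * nat) : exists W : nat -> option (seq nat),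
      forall c, (e q.2 = s q.1.2 /\ G q.1.2 (psi c) < q.1.1.+1%:R^-1) <->
                T q.2 [set i | cylinder (W i) c].
    move: q => [[k n] j] /=; have [_ Tj] := Tc j.
    have [ejs|ejs] := pselect (e j = s n).
      have [|W WP] := Tj (fun x => k.+1%:R^-1 - G n x).
        rewrite ejs; apply: (baire_at_comp (h := fun y => k.+1%:R^-1 - y)) => //.
        by move=> y; apply: cvgB; [exact: cvg_cst|exact: cvg_id].
      exists W => c; rewrite -(WP c) subr_gt0; split=> [[]//|//].
    have [W WP] := Tj _ (baire_at_cst (e j) 0).
    by exists W => c; rewrite -(WP c) ltxx; split=> [[]|].
  exists (fun i => if unpickle i is Some (k, n, j, m) then W (k, n, j) m else None).
  move=> c.
  have blkE k n j : block k n j [set i | cylinder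
      (if unpickle i is Some (k, n, j, m) then W (k, n, j) m else None) c] =
      [set i | cylinder (W (k, n, j) i) c].
    by apply/seteqP; split=> m; rewrite /block/mkset pickleK.
  split=> /=.
  + move=> F0; have [k kF] : exists k, k.+1%:R^-1 < F (psi c).
      by have [k] := ltr_add_invr F0; rewrite add0r; exists k.
    have /cvgr_ge/(_ _ kF)[N _ NG] := GF (psi c).
    exists k, N => n j Nn; rewrite blkE => /(proj2 (WP (k, n, j) c))/= [_].
    by rewrite ltNge (NG n).
  + move=> [k [N kN]]; apply: (@lt_le_trans _ _ k.+1%:R^-1); first by rewrite invr_gt0.
    apply: (cvgr_to_ge (GF (psi c))).
    exists N => // n Nn /=; rewrite leNgt; apply/negP => Gk.
    have [j ej] := te _ (st n).
    by apply: (kN n j Nn); rewrite blkE; apply/(proj1 (WP (k, n, j) c)).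
Qed.

(* The block [(k, n, j)] is unaffected by a change of one coordinate as soon as
   [n] is large, and a pattern of this shape only looks at large [n]. *)
Lemma tail_invariant_step (T : nat -> set (set nat)) :
  tail_invariant [set P | exists k N, forall n j, (N <= n)%N ->
                            ~ T j (block k n j P)].
Proof.
move=> P Q i PQ [k [N kN]].
have [N' N'P] : exists N', forall n (j m : nat), (N' <= n)%N ->
    pickle (k, n, j, m) != i.
  case E : (unpickle i : option (nat * nat * nat * nat)) => [[[[k' n'] j'] m']|].
    exists n'.+1 => n j m; apply: contraL => /eqP ni.
    by move: E; rewrite -ni pickleK => -[_ <- _ _]; rewrite -ltnNge.
  by exists 0%N => n j m _; apply/eqP => ni; move: E; rewrite -ni pickleK.
exists k, (maxn N N') => n j; rewrite geq_max => /andP[Nn N'n].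
suff -> : block k n j Q = block k n j P by exact: kN.
by apply/seteqP; split=> m; have [] := PQ _ (N'P n j m N'n).
Qed.

(** Nonemptiness is not tail invariant, so invariance is claimed only above the bottom, where a step
    has been made. *)
Lemma complete_pattern_ex t : exists T, complete_pattern t T /\
  ((exists s, ord_lt s t) -> tail_invariant T).
Proof.
elim/ord_ind: t => t IH; have [tbot|tgt] := ord_bot_or_gt t.
  exists [set P | exists m, P m]; split; first exact: complete_pattern_bot.
  by move=> [s /negP]; rewrite tbot.
have [e [et te]] := ord_lt_enum tgt.
have /choice[T TP] j := IH _ (et j).
exists [set P | exists k N, forall n j, (N <= n)%N -> ~ T j (block k n j P)].
split; last by move=> _; exact: tail_invariant_step.
by apply: complete_pattern_step et te _ => j; have [] := TP j.
Qed.

End patterns.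

(** * Coding the Baire space into [ellp] *)

Section ellp_facts.
Context {R : realType} {p : R} (p1 : 1 <= p).
Local Notation ellp := (ellp p1).

Let p0 : 0 < p. Proof. exact: lt_le_trans ltr01 p1. Qed.

Lemma le_sum_powR (x y : nat -> R) : (forall i, `|x i| <= `|y i|) ->
  (sum_powR p x <= sum_powR p y)%E.
Proof.
move=> xy; apply: lee_nneseries => [i _ _|i _]; rewrite lee_fin ?powR_ge0//.
by apply: ge0_ler_powR; rewrite ?nnegrE// ltW.
Qed.

Lemma ellp_dominated (x : nat -> R) (y : ellp) :
  (forall i, `|x i| <= `|y i|) -> x \in ellp_pred p.
Proof.
move=> xy; rewrite ellp_predE (le_lt_trans (le_sum_powR xy))//.
by rewrite -ellp_predE; exact: (valP y).
Qed.

Lemma ellp_norm_le (x y : ellp) : (forall i, `|x i| <= `|y i|) -> `|x| <= `|y|.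
Proof.
move=> xy; apply: ge0_ler_powR; rewrite ?nnegrE ?invr_ge0 ?(ltW p0)//.
- exact/fine_ge0/sum_powR_ge0.
- exact/fine_ge0/sum_powR_ge0.
- by apply: fine_le; rewrite ?ellp_sum_fin//; exact: le_sum_powR.
Qed.

Lemma ellp_coord_le (x : ellp) i : `|x i| <= `|x|.
Proof.
have -> : `|x i| = (`|x i| `^ p) `^ p^-1.
  by rewrite -powRrM divff ?gt_eqF// powRr1.
apply: ge0_ler_powR; rewrite ?nnegrE ?invr_ge0 ?(ltW p0) ?powR_ge0//.
  exact/fine_ge0/sum_powR_ge0.
rewrite -lee_fin fineK ?ellp_sum_fin// /sum_powR (@nneseriesD1 _ _ i)//.
by apply: leeDl; apply: nneseries_ge0 => k _ _; rewrite lee_fin powR_ge0.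
Qed.

Lemma ellp_abs_coord_continuous i :
  continuous (fun x : ellp => `|(x : nat -> R) i|).
Proof.
move=> a. apply/(@cvgrPdist_lt _ _ _ (nbhs a) (nbhs_filter a)) => e e0; near=> x.
apply: (le_lt_trans (ler_dist_dist _ _)).
apply: (le_lt_trans (ellp_coord_le (a - x) i)).
by near: x; exact: cvgr_dist_lt.
Unshelve. all: by end_near. Qed.

(** As [p >= 1], raising terms at most 1 to the power [p] does not increase them; a geometric series
    of sum 1 dominates. *)
Lemma half_pow_ellp : (fun i => (2 ^+ i.+1)^-1 : R) \in ellp_pred p.
Proof.
rewrite ellp_predE; apply: (@le_lt_trans _ _ 1%E); last exact: ltry.
have := @cvg_geometric_eseries_half R 1 0; rewrite expr0 divr1.
move=> /cvg_lim <-//; apply: lee_nneseries => [i _ _|i _]; rewrite lee_fin.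
  exact: powR_ge0.
rewrite addn1 natrX div1r ger0_norm ?invr_ge0 ?exprn_ge0//.
rewrite -[leRHS]powRr1 ?invr_ge0 ?exprn_ge0//.
apply: ger_powR => //; rewrite invr_gt0 exprn_gt0//= invf_le1 ?exprn_gt0//.
by rewrite exprn_ege1// ler1n.
Qed.

Let half : ellp := Ellp p1 half_pow_ellp.

(** Coordinate [i] tests [c] against a cylinder coded by [c] itself, the self-reference behind the
    diagonal argument. *)
Definition encode_val (c : nat -> nat) (i : nat) : R :=
  if cylinder (odflt None (unpickle (c i))) c then (2 ^+ i.+1)^-1 ^+ 2 else 0.

Lemma encode_subproof c : encode_val c \in ellp_pred p.
Proof.
apply: (@ellp_dominated _ half) => i /=; rewrite /encode_val.
case: ifP => _; last by rewrite normr0.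
rewrite normrX expr2 ler_piMr// ger0_norm ?invr_ge0 ?exprn_ge0//.
by rewrite invf_le1 ?exprn_gt0// exprn_ege1// ler1n.
Qed.

Definition encode c : ellp := Ellp p1 (encode_subproof c).

Lemma encode_gt0 c i :
  0 < `|encode c i| <-> cylinder (odflt None (unpickle (c i))) c.
Proof.
rewrite /= /encode_val; case: ifP => _; last by rewrite normr0 ltxx.
by rewrite normr_gt0 expf_neq0// invr_neq0// expf_neq0.
Qed.

Lemma mkseq_prefix (c c' : nat -> nat) m n : (m <= n)%N ->
  mkseq c' n = mkseq c n -> mkseq c' m = mkseq c m.
Proof.
move=> mn c'c; apply/eq_in_map => i; rewrite mem_iota add0n => /andP[_ im].
have := congr1 (nth 0%N ^~ i) c'c.
by rewrite !nth_mkseq ?(leq_trans im mn).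
Qed.

(** Coordinate [i] depends only on [c i] and on a prefix of [c] as long as the word coded by
    [c i]. *)
Lemma encode_local c M : exists n, forall c', mkseq c' n = mkseq c n ->
  forall i, (i < M)%N -> encode_val c' i = encode_val c i.
Proof.
pose len i := oapp size 0%N (odflt None (unpickle (c i)) : option (seq nat)).
exists (M + \sum_(i < M) len i)%N => c' c'c i iM.
have c'ci : c' i = c i.
  have in_n : (i < M + \sum_(i < M) len i)%N by exact: leq_trans iM (leq_addr _ _).
  by have := congr1 (nth 0%N ^~ i) c'c; rewrite !nth_mkseq.
rewrite /encode_val c'ci; congr (if _ then _ else _).
have : (len i <= M + \sum_(i < M) len i)%N.
  by rewrite (bigD1 (Ordinal iM))//= addnCA leq_addr.
rewrite /len; case: (odflt _ _) => //= w wn.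
by rewrite (mkseq_prefix wn c'c).
Qed.

(* The squares in [encode_val] give a spare factor: if the first [M] coordinates
   agree, the difference is dominated by [2^-M *: half]. *)
Lemma encode_continuous (F : ellp -> R) : continuous F ->
  forall c, 0 < F (encode c) ->
  exists n, forall c', mkseq c' n = mkseq c n -> 0 < F (encode c').
Proof.
move=> Fc c F0.
have /nbhs_ballP[e /= e0 eF] : \forall x \near encode c, 0 < F x.
  exact: (cvgr_gt (F (encode c)) (Fc _)).
(* This gives [|half| / e < M < 2 ^+ M], so [(2 ^+ M)^-1 *: half] has norm below [e]. *)
pose M := Num.bound (`|half| / e).
have [n nP] := encode_local c M.
exists n => c' c'c; apply: eF; rewrite -ball_normE /=.
apply: (@le_lt_trans _ _ `|(2 ^+ M)^-1 *: half|).
  apply: ellp_norm_le => i.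
  change (`|encode_val c i - encode_val c' i| <= `|(2 ^+ M)^-1 * (2 ^+ i.+1)^-1|).
  have [iM|Mi] := ltnP i M.
    by rewrite (nP _ c'c)// subrr normr0.
  apply: (@le_trans _ _ ((2 ^+ i.+1)^-1 ^+ 2)).
    have v0 : 0 <= (2 ^+ i.+1 : R)^-1 ^+ 2 by rewrite exprn_ge0.
    by rewrite /encode_val; case: ifP => _; case: ifP => _;
      rewrite ?subrr ?subr0 ?sub0r ?normrN ?normr0 ?ger0_norm.
  rewrite [leRHS]ger0_norm; last by rewrite mulr_ge0.
  rewrite expr2 ler_wpM2r// lef_pV2 ?posrE ?exprn_gt0//.
  by rewrite ler_weXn2l ?ler1n// ltnW.
rewrite normrZ ger0_norm// mulrC ltr_pdivrMr ?exprn_gt0//.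
rewrite mulrC -ltr_pdivrMr//.
apply: (@lt_le_trans _ _ M%:R); first by rewrite archi_boundP// divr_ge0// ltW.
by rewrite -natrX ler_nat ltnW// ltn_expl.
Qed.

End ellp_facts.

(** * Separation of the classes [alpha] and [alpha + 1] *)

Lemma baire_at_succ {R : realType} {X : topologicalType}
    {beta : countable_ordinal} (t : beta) (f : X -> R) :
  baire_at t f -> @baire_at R X (ord_succ beta) (Some t) f.
Proof.
elim=> {t f} [t f tbot fc|t f s F st _ IH Ff].
  by apply: baire_at_zero => // -[s|] //=; exact: tbot.
exact: (@baire_at_lim _ _ (ord_succ beta) _ _ (fun n => Some (s n)) F).
Qed.

Theorem theorem3p2 (R : realType) (alpha : countable_ordinal)
    (alpha_ge1 : ord_ge1 alpha) (p : R) (p1 : 1 <= p) :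
  exists f : ellp p1 -> R,
    [/\ strongly_separately_continuous f,
        baire_class (ord_succ alpha) f
      & ~ baire_class alpha f].
Proof.
have [T [[Tsigma Tcomplete] Ttail]] :=
  complete_pattern_ex (@encode_continuous R p p1) (None : ord_succ alpha).
have {}Ttail : tail_invariant T by apply: Ttail; case: alpha_ge1 => s; exists (Some s).
pose A : set (ellp p1) := [set x : ellp p1 | T [set i | 0 < `|x i|]].
have [h [bh Ah]] : baire_sigma (R := R) (None : ord_succ alpha) A.
  apply: (Tsigma (fun i x => `|x i|)) => i; exact: ellp_abs_coord_continuous.
exists (\1_A); split.
- move=> a k; suff /funext-> : forall x, `|\1_A x - \1_A (replace_coord a k x)| = 0 :> R.
    exact: (@cvg_cst _ _ _ (nbhs a) (nbhs_filter a)).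
  move=> x; suff AE : A x <-> A (replace_coord a k x).
    rewrite !indicE; suff -> : (x \in A) = (replace_coord a k x \in A).
      by rewrite subrr normr0.
    by apply/idP/idP; rewrite !inE => /AE.
  by split; apply: (Ttail _ _ k) => l lk; rewrite /= (negbTE lk).
(* [A] is a countable union of cozero sets of class [alpha]; the indicator of its complement costs
   one more limit. *)
- have -> : \1_A = (fun y => 1 - y) \o \1_[set x | forall q, h q x <= 0] :> (_ -> R).
    apply/funext => x; rewrite /= !indicE; case: (boolP (x \in A)).
      rewrite inE => /Ah[n hn]; rewrite memNset ?subr0// => /(_ n).
      by rewrite leNgt hn.
    move=> /negP xA; rewrite mem_set ?subrr// => q; rewrite leNgt.
    by apply/negP => hq; apply: xA; rewrite inE; apply/Ah; exists q.
  apply: baire_at_comp; first by move=> y; apply: cvgB; [exact: cvg_cst|exact: cvg_id].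
  (* [Some None] stands for [alpha], the outer [None] for [alpha + 1]. *)
  apply: (@baire_at_indic _ _ (ord_succ (ord_succ alpha)) None (fun=> Some None)) => // q.
  exact/baire_at_succ/bh.
- move=> bA.
  have [|W WP] := Tcomplete (fun x => 2^-1 - \1_A x).
    apply: (baire_at_comp (h := fun y => 2^-1 - y)) bA.
    by move=> y; apply: cvgB; [exact: cvg_cst|exact: cvg_id].
  (* Diagonal point: [c] encodes the cylinders that define [\1_A < 1/2]. *)
  pose c i := pickle (W i).
  have cE : [set i | 0 < `|encode p1 c i|] = [set i | cylinder (W i) c].
    apply/funext => i; apply/propext; have := encode_gt0 p1 c i.
    by rewrite {2}/c pickleK.
  have [] := WP c; rewrite -cE indicE; case: (boolP (_ \in A)) => cA.
    move=> _; move: cA; rewrite inE => cA /(_ cA).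
    by rewrite subr_gt0 ltNge invf_le1// ler1n.
  rewrite subr0 invr_gt0 ltr0n => /(_ isT) Tc _.
  by move: cA; rewrite notin_setE; apply.
Qed.
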